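(* Let $p>1$ be real, let $A,\Delta A\in\mathbb{C}^{n\times n}$, let $Q\in\mathbb{C}^{n\times n}$ be Hermitian positive definite, and put $\widetilde{A}=A+\Delta A$. If $$\|A\|<\sqrt{\frac{\lambda_{\min}^{p+1}(Q)}{p}}\qquad\text{and}\qquad \|\Delta A\|<\sqrt{\frac{\lambda_{\min}^{p+1}(Q)}{p}}-\|A\|,$$ then the equations $$X-A^{*}X^{-p}A=Q\qquad\text{and}\qquad \widetilde{X}-\widetilde{A}^*\widetilde{X}^{-p}\widetilde{A}=Q$$ have unique Hermitian positive definite solutions $X$ and $\widetilde{X}$, respectively. Furthermore, $$\frac{\|\widetilde{X}-X\|}{\|X\|}\leq\frac{2\|A\|+\|\Delta A\|}{\lambda_{\min}^{p+1}(Q)-p\|A\|^{2}}\,\|\Delta A\|.$$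
   Context: $\|\cdot\|$ is the spectral norm (operator 2-norm). $\lambda_{\min}(Q)$ is the smallest eigenvalue of $Q$ and $\lambda_{\min}^{p+1}(Q)=(\lambda_{\min}(Q))^{p+1}$. $A^*$ is the conjugate transpose. For Hermitian positive definite $X$, $X^{-p}$ is defined by the spectral functional calculus. *)

(* Defs.v *)
From HB Require Import structures.
From mathcomp Require Import all_boot all_order all_algebra.
From mathcomp Require Import complex.
From mathcomp Require Import classical_sets reals exp.

Set Implicit Arguments.
Unset Strict Implicit.
Unset Printing Implicit Defensive.

Import Order.TTheory GRing.Theory Num.Theory.
Local Open Scope ring_scope.
Local Open Scope complex_scope.
Local Open Scope sesquilinear_scope.
Local Open Scope classical_set_scope.

Definition vnorm2 (R : realType) (n : nat) (x : 'cV[R[i]]_n) : R :=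
  Num.sqrt (\sum_(i < n) (Normc.normc (x i 0)) ^+ 2).

Definition specnorm (R : realType) (n : nat) (A : 'M[R[i]]_n) : R :=
  sup [set vnorm2 (A *m x) | x in [set x : 'cV[R[i]]_n | vnorm2 x = 1]].

(* For Hermitian Q with 0 < n the set of eigenvalues is finite, nonempty and
   real, so this infimum is the smallest eigenvalue. *)
Definition lambda_min (R : realType) (n : nat) (Q : 'M[R[i]]_n) : R :=
  inf [set l : R | eigenvalue Q l%:C].

(* In R[i], 0 < z means that z is real and positive. *)
Definition posdefmx (R : realType) (n : nat) (X : 'M[R[i]]_n) : Prop :=
  X \is hermsymmx /\
  forall x : 'cV[R[i]]_n, x != 0 -> 0 < (x ^t* *m X *m x) 0 0.

(* U^-1 diag(f(l_1), ..., f(l_n)) U for a unitary diagonalization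
   X = U^-1 diag(l_1, ..., l_n) U; meaningful for Hermitian X, whose l_i are
   real. *)
Definition spectral_calculus (R : realType) (n : nat) (f : R -> R)
    (X : 'M[R[i]]_n) : 'M[R[i]]_n :=
  invmx (spectralmx X)
  *m diag_mx (map_mx (fun z : R[i] => (f (complex.Re z))%:C) (spectral_diag X))
  *m spectralmx X.

Definition mxpowR (R : realType) (n : nat) (X : 'M[R[i]]_n) (s : R) :
    'M[R[i]]_n :=
  spectral_calculus (fun t : R => powR t s) X.

Definition posdef_solution (R : realType) (n : nat) (p : R)
    (A Q X : 'M[R[i]]_n) : Prop :=
  posdefmx X /\ X - A ^t* *m mxpowR X (- p) *m A = Q.

(* Main.v *)
(* On {X >= l I} with l > 0, the map X |-> X^(-p) is Lipschitz in operator norm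
   with constant p l^(-p-1). For X^(1/2) this is seen at an eigenvector of
   B - C, where <(B^2 - C^2)v, v> = t <(B + C)v, v>; iterating square roots
   gives X^s with s = 2^(-k), inverting gives X^(-s), multiplying gives all
   dyadic exponents, and continuity of the quadratic form in the exponent gives
   all real ones. With l = lambda_min Q, the map X |-> Q + A^* X^(-p) A is
   then a contraction of {X >= l I} with constant q = p |A|^2 / l^(p+1) < 1,
   whence existence and uniqueness. Subtracting the two equations yields
   |Xt - X| <= q |Xt - X| + l^(-p) (2|A| + |dA|) |dA|, and |X| >= l. *)
Require Import Defs.
From mathcomp Require Import all_boot all_order all_algebra.
From mathcomp Require Import complex.
From mathcomp Require Import boolp classical_sets reals.
From mathcomp Require Import topology normedtype sequences exp.
From mathcomp Require Import ring lra.

Set Implicit Arguments.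
Unset Strict Implicit.
Unset Printing Implicit Defensive.

Import Order.TTheory GRing.Theory Num.Theory.
Import numFieldNormedType.Exports.
Local Open Scope ring_scope.
Local Open Scope complex_scope.
Local Open Scope sesquilinear_scope.

(** * The real inner product on complex vectors and operator bounds *)

Section RealInnerProduct.
Variables (R : realType) (n : nat).
Implicit Types (u v w : 'cV[R[i]]_n) (M N : 'M[R[i]]_n) (t c : R).

(* The real part of the Hermitian product is a real inner product for which
   [M ^t*] is still the adjoint of [M]. *)
Definition rdot u v : R := complex.Re ((u ^t* *m v) 0 0).

Lemma rdotE u v : rdot u v =
  \sum_i (complex.Re (u i 0) * complex.Re (v i 0) +
          complex.Im (u i 0) * complex.Im (v i 0)).
Proof.
rewrite /rdot mxE raddf_sum; apply: eq_bigr => i _; rewrite !mxE.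
by case: (u i 0) (v i 0) => a b [c d] /=; rewrite mulNr opprK.
Qed.

Lemma rdotC u v : rdot u v = rdot v u.
Proof. by rewrite !rdotE; apply: eq_bigr => i _; ring. Qed.

Lemma rdotDr u v w : rdot u (v + w) = rdot u v + rdot u w.
Proof. by rewrite /rdot mulmxDr mxE raddfD. Qed.

Lemma rdotZr u t v : rdot u (t%:C *: v) = t * rdot u v.
Proof.
rewrite !rdotE mulr_sumr; apply: eq_bigr => i _; rewrite mxE.
by case: (u i 0) (v i 0) => a b [c d] /=; ring.
Qed.

Lemma rdotNr u v : rdot u (- v) = - rdot u v.
Proof. by rewrite /rdot mulmxN mxE raddfN. Qed.

Lemma rdotBr u v w : rdot u (v - w) = rdot u v - rdot u w.
Proof. by rewrite rdotDr rdotNr. Qed.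

Lemma rdotBl u v w : rdot (v - w) u = rdot v u - rdot w u.
Proof. by rewrite rdotC rdotBr !(rdotC u). Qed.

Lemma rdotDl u v w : rdot (v + w) u = rdot v u + rdot w u.
Proof. by rewrite rdotC rdotDr !(rdotC u). Qed.

Lemma rdotZl u t v : rdot (t%:C *: v) u = t * rdot v u.
Proof. by rewrite rdotC rdotZr rdotC. Qed.

Lemma rdot_adj M u v : rdot (M *m u) v = rdot u (M ^t* *m v).
Proof. by rewrite /rdot trmx_mul map_mxM mulmxA. Qed.

Lemma rdot_mulB M N u v :
  rdot u ((M - N) *m v) = rdot u (M *m v) - rdot u (N *m v).
Proof. by rewrite mulmxBl rdotBr. Qed.

Lemma rdot_ge0 u : 0 <= rdot u u.
Proof. by rewrite rdotE sumr_ge0// => i _; rewrite -!expr2 addr_ge0 ?sqr_ge0. Qed.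

Lemma rdot_eq0 u : rdot u u = 0 -> u = 0.
Proof.
rewrite rdotE => /eqP; rewrite psumr_eq0; last first.
  by move=> i _; rewrite -!expr2 addr_ge0 ?sqr_ge0.
move=> /allP u0; apply/matrixP => i j; rewrite ord1 mxE.
have := u0 i (mem_index_enum i); case: (u i 0) => a b /=.
by rewrite -!expr2 paddr_eq0 ?sqr_ge0// !sqrf_eq0 => /andP[/eqP-> /eqP->].
Qed.

Lemma sqr_vnorm2 u : vnorm2 u ^+ 2 = rdot u u.
Proof.
have -> : rdot u u = \sum_i Normc.normc (u i 0) ^+ 2.
  rewrite rdotE; apply: eq_bigr => i _; case: (u i 0) => a b /=.
  by rewrite sqr_sqrtr -?expr2 ?addr_ge0 ?sqr_ge0.
by rewrite sqr_sqrtr// sumr_ge0// => i _; rewrite sqr_ge0.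
Qed.

Lemma vnorm2_ge0 u : 0 <= vnorm2 u.
Proof. exact: sqrtr_ge0. Qed.

Lemma vnorm2_eq0 u : vnorm2 u = 0 -> u = 0.
Proof. by move=> u0; apply: rdot_eq0; rewrite -sqr_vnorm2 u0 expr0n. Qed.

Lemma vnorm2_0 : vnorm2 (0 : 'cV[R[i]]_n) = 0.
Proof.
by apply/eqP; rewrite -sqrf_eq0 sqr_vnorm2 /rdot mulmx0 mxE.
Qed.

Lemma vnorm2Z t u : vnorm2 (t%:C *: u) = `|t| * vnorm2 u.
Proof.
apply/eqP; rewrite -(@eqrXn2 _ 2) ?vnorm2_ge0 ?mulr_ge0 ?normr_ge0 ?vnorm2_ge0//.
by rewrite exprMn !sqr_vnorm2 rdotZl rdotZr mulrA real_normK ?num_real.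
Qed.

Lemma vnorm2N u : vnorm2 (- u) = vnorm2 u.
Proof.
apply/eqP; rewrite -(@eqrXn2 _ 2) ?vnorm2_ge0//.
by rewrite !sqr_vnorm2 rdotNr rdotC rdotNr opprK.
Qed.

(** Cauchy-Schwarz: with [a], [b] the norms of [u], [v], the vector [b u - a v] has squared norm
    [2ab (ab - <u, v>)]. *)
Lemma rdot_le u v : rdot u v <= vnorm2 u * vnorm2 v.
Proof.
have [/vnorm2_eq0 ->|u0] := eqVneq (vnorm2 u) 0.
  by rewrite rdotC /rdot mulmx0 mxE mulr_ge0 ?vnorm2_ge0.
have [/vnorm2_eq0 ->|v0] := eqVneq (vnorm2 v) 0.
  by rewrite /rdot mulmx0 mxE mulr_ge0 ?vnorm2_ge0.
have up : 0 < vnorm2 u by rewrite lt_neqAle eq_sym u0 vnorm2_ge0.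
have vp : 0 < vnorm2 v by rewrite lt_neqAle eq_sym v0 vnorm2_ge0.
have := rdot_ge0 ((vnorm2 v)%:C *: u - (vnorm2 u)%:C *: v).
rewrite rdotBr !rdotBl !rdotZl !rdotZr (rdotC v u) -!sqr_vnorm2.
set a := vnorm2 u in up *; set b := vnorm2 v in vp *; set d := rdot u v.
move=> h; have : 0 <= (2 * (a * b)) * (a * b - d) by lra.
by rewrite pmulr_rge0 ?subr_ge0 ?mulr_gt0.
Qed.

Lemma norm_rdot_le u v : `|rdot u v| <= vnorm2 u * vnorm2 v.
Proof. by rewrite ler_norml rdot_le -(vnorm2N v) lerNl -rdotNr rdot_le. Qed.

Lemma vnorm2D u v : vnorm2 (u + v) <= vnorm2 u + vnorm2 v.
Proof.
rewrite -(@ler_pXn2r _ 2) ?nnegrE ?addr_ge0 ?vnorm2_ge0// sqrrD.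
rewrite !sqr_vnorm2 rdotDr !rdotDl (rdotC v u).
by have := rdot_le u v; lra.
Qed.

(* [M] has operator norm at most [c], including when [n = 0]. *)
Definition opb M c := forall x, vnorm2 (M *m x) <= c * vnorm2 x.

Lemma opbD M N c d : opb M c -> opb N d -> opb (M + N) (c + d).
Proof.
move=> hM hN x; rewrite mulmxDl mulrDl.
by apply: le_trans (vnorm2D _ _) _; apply: lerD.
Qed.

Lemma opbN M c : opb M c -> opb (- M) c.
Proof. by move=> hM x; rewrite mulNmx vnorm2N. Qed.

Lemma opbB M N c d : opb M c -> opb N d -> opb (M - N) (c + d).
Proof. by move=> hM hN; apply: opbD => //; apply: opbN. Qed.

Lemma opbM M N c d : 0 <= c -> opb M c -> opb N d -> opb (M *m N) (c * d).
Proof.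
move=> c0 hM hN x; rewrite -mulmxA -mulrA.
by apply: le_trans (hM _) _; apply: ler_wpM2l.
Qed.

Lemma opb_le M c d : c <= d -> opb M c -> opb M d.
Proof. by move=> cd h x; apply: le_trans (h x) _; rewrite ler_wpM2r ?vnorm2_ge0. Qed.

Lemma opb_eq M c d : c = d -> opb M c -> opb M d.
Proof. by move->. Qed.

(** [|M^* x|^2 = <x, M M^* x> <= |x| c |M^* x|], and one factor cancels. *)
Lemma opb_adj M c : 0 <= c -> opb M c -> opb (M ^t*) c.
Proof.
move=> c0 hM x; have [->|] := eqVneq (vnorm2 (M ^t* *m x)) 0.
  by rewrite mulr_ge0 ?vnorm2_ge0.
rewrite neq_lt ltNge vnorm2_ge0 /= => p; rewrite -(ler_pM2l p) -expr2.
rewrite sqr_vnorm2 rdot_adj trmxCK; apply: le_trans (rdot_le _ _) _.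
apply: le_trans (ler_wpM2l (vnorm2_ge0 _) (hM _)) _.
by rewrite le_eqVlt; apply/orP; left; apply/eqP; ring.
Qed.

Lemma opb_quad M c x : opb M c -> `|rdot x (M *m x)| <= c * rdot x x.
Proof.
move=> hM; apply: le_trans (norm_rdot_le _ _) _.
by rewrite -sqr_vnorm2 expr2 mulrCA ler_wpM2l ?vnorm2_ge0.
Qed.

End RealInnerProduct.

(** * Unitarily diagonalized matrices with real spectrum *)

Section UnitaryDiagonal.
Variables (R : realType) (n : nat).
Implicit Types (v : 'cV[R[i]]_n) (M N P : 'M[R[i]]_n) (r s : 'I_n -> R) (c : R).

(** All functions of one Hermitian matrix share the same [P], so their products, quadratic forms and
    bounds are computed on [r] alone. *)
Definition usp P r : 'M[R[i]]_n :=
  P ^t* *m diag_mx (\row_i (r i)%:C) *m P.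

Lemma eq_usp P r s : r =1 s -> usp P r = usp P s.
Proof.
move=> rs; rewrite /usp (_ : \row_i (r i)%:C = \row_i (s i)%:C)//.
by apply/rowP => i; rewrite !mxE rs.
Qed.

Lemma usp_adj P r : (usp P r) ^t* = usp P r.
Proof.
rewrite /usp !trmx_mul !map_mxM trmxCK tr_diag_mx map_diag_mx mulmxA.
rewrite (_ : map_mx _ (\row_i _) = \row_i (r i)%:C)//.
by apply/rowP => i; rewrite !mxE; exact: conjc_real.
Qed.

Lemma unitarymxKl P : P \is unitarymx -> P ^t* *m P = 1%:M.
Proof. by move=> /unitarymxP/mulmx1C. Qed.

Lemma usp_mul P r s : P \is unitarymx ->
  usp P r *m usp P s = usp P (fun i => r i * s i).
Proof.
move=> uP; rewrite /usp -!mulmxA (mulmxA P) (unitarymxP uP) mul1mx.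
rewrite (mulmxA (diag_mx _) (diag_mx _)) mulmx_diag; congr (_ *m (diag_mx _ *m _)).
by apply/rowP => i; rewrite !mxE rmorphM.
Qed.

Lemma usp1 P : P \is unitarymx -> usp P (fun=> 1) = 1%:M.
Proof.
move=> uP; rewrite /usp -[RHS](unitarymxKl uP); congr (_ *m _).
rewrite -[RHS]mulmx1; congr (_ *m _).
by apply/matrixP => i j; rewrite !mxE; case: eqP.
Qed.

(* The squared moduli of the coordinates of [v] in the eigenbasis. *)
Definition specwt P v i : R :=
  complex.Re ((P *m v) i 0) ^+ 2 + complex.Im ((P *m v) i 0) ^+ 2.

Lemma specwt_ge0 P v i : 0 <= specwt P v i.
Proof. by rewrite addr_ge0 ?sqr_ge0. Qed.

Lemma usp_quad P r v :
  rdot v (usp P r *m v) = \sum_i r i * specwt P v i.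
Proof.
rewrite /usp -!mulmxA -rdot_adj rdotE; apply: eq_bigr => i _.
rewrite mul_diag_mx !mxE /specwt mxE.
by case: (\sum_j _) => a b /=; ring.
Qed.

Lemma sum_specwt P v : P \is unitarymx -> \sum_i specwt P v i = rdot v v.
Proof.
move=> uP; have -> : rdot v v = rdot v (P ^t* *m (P *m v)).
  by rewrite mulmxA unitarymxKl// mul1mx.
by rewrite -rdot_adj rdotE; apply: eq_bigr.
Qed.

Lemma usp_opb P r c : P \is unitarymx ->
  (forall i, `|r i| <= c) -> opb (usp P r) c.
Proof.
move=> uP rc x.
(* Without an index nothing forces [c] to be nonnegative, so the empty vector is treated apart. *)
have [n0|[i0 _]] : ('I_n -> False) \/ exists i0 : 'I_n, True.
  by case: n r P x uP rc => [|m] *; [left; case|right; exists ord0].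
- suff -> : x = 0 by rewrite mulmx0 vnorm2_0 mulr0.
  by apply/matrixP => i; case: (n0 i).
have c0 : 0 <= c by apply: le_trans (rc i0); apply: normr_ge0.
rewrite -(@ler_pXn2r _ 2) ?nnegrE ?mulr_ge0 ?vnorm2_ge0//.
rewrite exprMn !sqr_vnorm2 rdot_adj usp_adj mulmxA usp_mul// usp_quad.
rewrite -(sum_specwt x uP) mulr_sumr; apply: ler_sum => i _.
by rewrite ler_wpM2r ?specwt_ge0// -expr2 -real_normK ?num_real ?ler_pXn2r ?nnegrE.
Qed.

Lemma usp_eig P r i : P \is unitarymx ->
  let v := P ^t* *m delta_mx i (0 : 'I_1) in
  rdot v v = 1 /\ usp P r *m v = (r i)%:C *: v.
Proof.
move=> uP v; split.
  rewrite -(sum_specwt v uP) (bigD1 i)//= big1 => [|j ji].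
    rewrite /specwt mulmxA (unitarymxP uP) mul1mx mxE !eqxx /=.
    by rewrite expr1n expr0n !addr0.
  rewrite /specwt mulmxA (unitarymxP uP) mul1mx mxE (negPf ji) /=.
  by rewrite !expr0n addr0.
rewrite /usp -!mulmxA (mulmxA P (P ^t*)) (unitarymxP uP) mul1mx /v scalemxAr.
congr (_ *m _); rewrite mul_diag_mx; apply/matrixP => j k; rewrite !mxE.
by have [->|] := eqVneq j i; rewrite ?mulr0.
Qed.

Definition speceig M i : R := complex.Re (spectral_diag M 0 i).

Lemma spectral_calculusE (f : R -> R) M :
  spectral_calculus f M = usp (spectralmx M) (fun i => f (speceig M i)).
Proof.
rewrite /spectral_calculus /usp (invmx_unitary (spectral_unitarymx M)).
rewrite (_ : map_mx _ _ = \row_i (f (speceig M i))%:C)//.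
by apply/rowP => i; rewrite !mxE.
Qed.

Lemma hermsymmx_adj M : (M \is hermsymmx) = (M ^t* == M).
Proof. by rewrite is_hermitianmxE expr0 scale1r eq_sym. Qed.

Lemma hermitian_uspE M : M ^t* = M -> M = usp (spectralmx M) (speceig M).
Proof.
move=> /eqP; rewrite -hermsymmx_adj => hM.
have /orthomx_spectralP := hermitian_normalmx hM.
rewrite (invmx_unitary (spectral_unitarymx M)) {1}/usp => {1}->.
rewrite (_ : spectral_diag M = \row_i (speceig M i)%:C)//.
apply/rowP => i; rewrite !mxE.
have /mxOverP/(_ 0 i) := hermitian_spectral_diag_real hM.
by move=> /RRe_real.
Qed.

(** The operator norm of a Hermitian matrix is its largest absolute eigenvalue, so unit eigenvectors
    suffice as tests. *)
Lemma hermitian_opb M c : M ^t* = M ->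
  (forall v t, rdot v v = 1 -> M *m v = t%:C *: v -> `|t| <= c) -> opb M c.
Proof.
move=> hM ev; rewrite (hermitian_uspE hM).
apply: usp_opb => [|i]; first exact: spectral_unitarymx.
have [v1 Mv] := usp_eig (speceig M) i (spectral_unitarymx M).
by apply: ev v1 _; rewrite {1}(hermitian_uspE hM).
Qed.

(** Converse of [opb_quad] for Hermitian matrices. It reduces a norm bound to scalar inequalities,
    in which a limit in the exponent can be taken. *)
Lemma hermitian_opb_quad M c : M ^t* = M ->
  (forall v, `|rdot v (M *m v)| <= c * rdot v v) -> opb M c.
Proof.
move=> hM q; apply: hermitian_opb => // v t v1 Mv.
by have := q v; rewrite Mv rdotZr v1 !mulr1.
Qed.

(* [c I <= M] in the Loewner order, for Hermitian [M]. *)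
Definition loew c M := forall v, c * rdot v v <= rdot v (M *m v).

Lemma usp_loew P r c : P \is unitarymx ->
  (forall i, c <= r i) -> loew c (usp P r).
Proof.
move=> uP rc v; rewrite usp_quad -(sum_specwt v uP) mulr_sumr.
by apply: ler_sum => i _; rewrite ler_wpM2r ?specwt_ge0.
Qed.

Lemma speceig_ge M c i : M ^t* = M -> loew c M -> c <= speceig M i.
Proof.
move=> hM lM; have [v1 Mv] := usp_eig (speceig M) i (spectral_unitarymx M).
move: Mv; set v := _ *m _ in v1 *; rewrite -(hermitian_uspE hM) => Mv.
by have := lM v; rewrite Mv rdotZr v1 !mulr1.
Qed.

End UnitaryDiagonal.

(** The resolvent identity, with [U'] and [V'] as inverses; it carries a Lipschitz bound from [X^s]
    over to [X^(-s)]. *)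
Lemma inverse_diff (S : pzRingType) (n : nat) (U V U' V' : 'M[S]_n) :
  U *m U' = 1%:M -> V' *m V = 1%:M -> U - V = U *m (- (U' - V')) *m V.
Proof.
by move=> hU hV; rewrite opprB mulmxBr mulmxBl -mulmxA hU hV mulmx1 mul1mx.
Qed.

Lemma product_diff (S : pzRingType) (n : nat) (U V U' V' : 'M[S]_n) :
  U *m U' - V *m V' = U *m (U' - V') + (U - V) *m V'.
Proof. by rewrite mulmxBr mulmxBl addrA subrK. Qed.

Lemma adj_sub (C : numClosedFieldType) (n : nat) (U V : 'M[C]_n) :
  U ^t* = U -> V ^t* = V -> (U - V) ^t* = U - V.
Proof. by move=> hU hV; rewrite raddfB /= map_mxB hU hV. Qed.

(** * Real powers of positive matrices and their Lipschitz constants *)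

Section MatrixPowers.
Variables (R : realType) (n : nat).
Implicit Types (v : 'cV[R[i]]_n) (X Y B C : 'M[R[i]]_n) (l c s t : R).

Lemma powRD_gt0 l s t : 0 < l -> powR l (s + t) = powR l s * powR l t.
Proof. by move=> l0; rewrite powRD// (gt_eqF l0) implybT. Qed.

Definition posge l X := X ^t* = X /\ loew l X.

Lemma mxpowRE X s :
  mxpowR X s = usp (spectralmx X) (fun i => powR (speceig X i) s).
Proof. exact: spectral_calculusE. Qed.

Lemma mxpowR_adj X s : (mxpowR X s) ^t* = mxpowR X s.
Proof. by rewrite mxpowRE usp_adj. Qed.

Lemma mxpowRD l X s t : 0 < l -> posge l X ->
  mxpowR X s *m mxpowR X t = mxpowR X (s + t).
Proof.
move=> l0 [hX lX]; rewrite !mxpowRE (usp_mul _ _ (spectral_unitarymx X)).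
apply: eq_usp => i; rewrite powRD_gt0//.
by rewrite (lt_le_trans l0)// speceig_ge.
Qed.

Lemma mxpowR0 X : mxpowR X 0 = 1%:M.
Proof.
rewrite mxpowRE -(usp1 (spectral_unitarymx X)).
by apply: eq_usp => i; rewrite powRr0.
Qed.

Lemma mxpowR1 l X : 0 < l -> posge l X -> mxpowR X 1 = X.
Proof.
move=> l0 [hX lX]; rewrite mxpowRE [RHS](hermitian_uspE hX).
apply: eq_usp => i; rewrite powRr1//.
by rewrite ltW// (lt_le_trans l0)// speceig_ge.
Qed.

Lemma posge_mxpowR l X s : 0 < l -> 0 <= s -> posge l X ->
  posge (powR l s) (mxpowR X s).
Proof.
move=> l0 s0 [hX lX]; split; first exact: mxpowR_adj.
rewrite mxpowRE; apply: usp_loew => [|i]; first exact: spectral_unitarymx.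
have h := speceig_ge i hX lX.
by apply: ge0_ler_powR; rewrite ?nnegrE ?(le_trans (ltW l0) h)// ltW.
Qed.

Lemma opb_mxpowRN l X s : 0 < l -> 0 <= s -> posge l X ->
  opb (mxpowR X (- s)) (powR l (- s)).
Proof.
move=> l0 s0 [hX lX]; rewrite mxpowRE; apply: usp_opb => [|i].
  exact: spectral_unitarymx.
have h := speceig_ge i hX lX.
rewrite ger0_norm ?powR_ge0// !powRN lef_pV2 ?posrE ?powR_gt0 ?(lt_le_trans l0 h)//.
by apply: ge0_ler_powR; rewrite ?nnegrE ?(le_trans (ltW l0) h)// ltW.
Qed.

(* At an eigenvector [v] of [B - C] with eigenvalue [t], the quadratic form of
   [B^2 - C^2 = B (B - C) + (B - C) C] is [t] times that of [B + C]. *)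
Lemma opb_sqr_diff b B C c : 0 < b -> posge b B -> posge b C ->
  opb (B *m B - C *m C) c -> opb (B - C) (c / (2 * b)).
Proof.
move=> b0 [hB lB] [hC lC] hc.
have hD := adj_sub hB hC.
apply: hermitian_opb => // v t v1 Dv.
rewrite ler_pdivlMr ?mulr_gt0//.
have := opb_quad v hc; rewrite v1 mulr1; apply: le_trans.
rewrite product_diff mulmxDl rdotDr -!mulmxA Dv -scalemxAr rdotZr.
rewrite -[in X in _ + X]hD -rdot_adj Dv rdotZl -mulrDr normrM.
apply: ler_wpM2l => //; have := lB v; have := lC v; rewrite v1 !mulr1 => qC qB.
by apply: le_trans (ler_norm _); lra.
Qed.

(** [s l^(s-1)] is the slope of [t^s] at [l], its maximum on [t >= l] when [0 <= s <= 1]; the bound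
    is established for [s = 2^(-k)]. *)
Definition powR_lipschitz s := forall l X Y c, 0 < l -> 0 <= c ->
  posge l X -> posge l Y -> opb (X - Y) c ->
  opb (mxpowR X s - mxpowR Y s) (s * powR l (s - 1) * c).

(** [s l^(-s-1)] is the absolute slope of [t^(-s)] at [l], its maximum on [t >= l] for every
    [s >= 0]; hence exponents may grow by addition. *)
Definition powRN_lipschitz s := forall l X Y c, 0 < l -> 0 <= c ->
  posge l X -> posge l Y -> opb (X - Y) c ->
  opb (mxpowR X (- s) - mxpowR Y (- s)) (s * powR l (- s - 1) * c).

Lemma powR_lipschitz1 : powR_lipschitz 1.
Proof.
move=> l X Y c l0 c0 hX hY hc.
by rewrite (mxpowR1 l0 hX) (mxpowR1 l0 hY) subrr powRr0 mulr1 mul1r.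
Qed.

(** [opb_sqr_diff] applies to [X^(s/2)] and [Y^(s/2)], both at least [l^(s/2)]: the constant becomes
    [s l^(s-1) / (2 l^(s/2)) = (s/2) l^(s/2-1)]. *)
Lemma powR_lipschitz_half s : 0 <= s ->
  powR_lipschitz s -> powR_lipschitz (s / 2).
Proof.
move=> s0 hs l X Y c l0 c0 hX hY hc.
have s20 : 0 <= s / 2 by rewrite divr_ge0.
have := hs _ _ _ _ l0 c0 hX hY hc.
have {1 2}-> : s = s / 2 + s / 2 by lra.
rewrite -(mxpowRD _ _ l0 hX) -(mxpowRD _ _ l0 hY).
have ls : 0 < powR l (s / 2) by rewrite powR_gt0.
move=> /(opb_sqr_diff ls (posge_mxpowR l0 s20 hX) (posge_mxpowR l0 s20 hY)).
apply: opb_eq.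
have -> : s - 1 = s / 2 + (s / 2 - 1) by lra.
rewrite (powRD_gt0 (s / 2) (s / 2 - 1) l0).
by field; rewrite gt_eqF.
Qed.

(** The outer factors of the resolvent identity contribute [l^(-s)] each:
    [l^(-s) s l^(s-1) l^(-s) = s l^(-s-1)]. *)
Lemma powRN_lipschitz_inv s : 0 <= s -> powR_lipschitz s -> powRN_lipschitz s.
Proof.
move=> s0 hs l X Y c l0 c0 hX hY hc.
have hn := opbN (hs _ _ _ _ l0 c0 hX hY hc).
have hXX : mxpowR X (- s) *m mxpowR X s = 1%:M.
  by rewrite (mxpowRD (- s) s l0 hX) addNr mxpowR0.
have hYY : mxpowR Y s *m mxpowR Y (- s) = 1%:M.
  by rewrite (mxpowRD s (- s) l0 hY) subrr mxpowR0.
rewrite (inverse_diff hXX hYY).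
have pX := opb_mxpowRN l0 s0 hX; have pY := opb_mxpowRN l0 s0 hY.
have d0 : 0 <= powR l (- s) * (s * powR l (s - 1) * c).
  by rewrite !mulr_ge0 ?powR_ge0.
apply: opb_eq (opbM d0 (opbM (powR_ge0 _ _) pX hn) pY).
have -> : - s - 1 = (- s + (s - 1)) + - s by lra.
by rewrite !powRD_gt0//; ring.
Qed.

(** By the Leibniz rule the constants add without loss: [l^(-s) t l^(-t-1) + s l^(-s-1) l^(-t) =
    (s+t) l^(-s-t-1)]. *)
Lemma powRN_lipschitzD s t : 0 <= s -> 0 <= t ->
  powRN_lipschitz s -> powRN_lipschitz t -> powRN_lipschitz (s + t).
Proof.
move=> s0 t0 hs ht l X Y c l0 c0 hX hY hc.
have {}hs := hs _ _ _ _ l0 c0 hX hY hc; have {}ht := ht _ _ _ _ l0 c0 hX hY hc.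
rewrite {1 2}opprD -(mxpowRD (- s) (- t) l0 hX) -(mxpowRD (- s) (- t) l0 hY).
rewrite product_diff.
have pX := opb_mxpowRN l0 s0 hX; have pY := opb_mxpowRN l0 t0 hY.
have h1 := opbM (powR_ge0 _ _) pX ht.
have d0 : 0 <= s * powR l (- s - 1) * c by rewrite !mulr_ge0 ?powR_ge0.
apply: opb_eq (opbD h1 (opbM d0 hs pY)).
have -> : - (s + t) - 1 = - s + (- t + - 1) by lra.
by rewrite !powRD_gt0//; ring.
Qed.

Lemma powRN_lipschitz0 : powRN_lipschitz 0.
Proof.
move=> l X Y c *; rewrite oppr0 !mxpowR0 subrr !mul0r => x.
by rewrite mul0mx vnorm2_0 mul0r.
Qed.

Lemma powRN_lipschitz_dyadic m k : powRN_lipschitz (m%:R / 2 ^+ k).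
Proof.
have p0 : 0 <= (2 ^+ k)^-1 :> R by rewrite invr_ge0 exprn_ge0.
have hk : powR_lipschitz (2 ^+ k)^-1.
  elim: k {p0} => [|k IH]; first by rewrite expr0 invr1; exact: powR_lipschitz1.
  rewrite exprS invfM mulrC; apply: powR_lipschitz_half IH.
  by rewrite invr_ge0 exprn_ge0.
elim: m => [|m IH]; first by rewrite mul0r; exact: powRN_lipschitz0.
rewrite -natr1 mulrDl mul1r; apply: powRN_lipschitzD => //.
- by rewrite mulr_ge0.
- exact: powRN_lipschitz_inv.
Qed.

End MatrixPowers.

(** * Scalar limits, density of dyadic numbers, and all real exponents *)

Lemma le0_expr_bound (R : realType) (a c z : R) :
  0 <= z < 1 -> (forall k, a <= c * z ^+ k) -> a <= 0.
Proof.
move=> /andP[z0 z1] h.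
have hz : (c * z ^+ k @[k --> \oo] --> c * 0)%classic.
  by apply: cvgMr; apply: cvg_expr; rewrite ger0_norm.
rewrite -(mulr0 c) -(cvg_lim _ hz)//.
apply: limr_ge; first by apply/cvg_ex; exists (c * 0).
by near=> k; apply: h.
Unshelve. all: by end_near.
Qed.

(** If [g s] were positive, [g] would be positive within some distance [e] of [s], and a dyadic
    number lies that close. *)
Lemma continuous_dyadic_le0 (R : realType) (g : R -> R) (s : R) :
  0 <= s -> continuous g -> (forall m k, g (m%:R / 2 ^+ k) <= 0) -> g s <= 0.
Proof.
move=> s0 cg gle; rewrite leNgt; apply/negP => gs.
have /cvgrPdist_lt/(_ _ gs)/nbhs_ballP[e /= e0 he] := cg s.
(* This [k] makes [2^k] exceed [1/e]; the integer part [m] of [s 2^k] then leaves an error below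
   [2^(-k) < e]. *)
pose k := Num.bound e^-1; have p2 : 0 < 2 ^+ k :> R by rewrite exprn_gt0.
have ek : (2 ^+ k)^-1 < e.
  by rewrite invf_plt ?posrE// upper_nthrootP.
have /truncn_itv/andP[] : 0 <= s * 2 ^+ k by rewrite mulr_ge0// ltW.
set m := Num.trunc _ => lm um.
have : `|s - m%:R / 2 ^+ k| < e.
  have l1 : m%:R / 2 ^+ k <= s by rewrite ler_pdivrMr.
  have : s < (m%:R + 1) / 2 ^+ k by rewrite ltr_pdivlMr// natr1.
  by rewrite ger0_norm ?subr_ge0// mulrDl mul1r; lra.
move=> /he /=; have := gle m k.
by rewrite ltr_norml => g0 /andP[_]; lra.
Qed.

Lemma continuous_powRN (R : realType) (x : R) :
  0 < x -> continuous (fun q : R => powR x (- q)).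
Proof.
move=> x0 q; rewrite /powR gt_eqF//.
apply: (@cvg_comp _ _ _ (fun q => - q * ln x) expR); last exact: continuous_expR.
by apply: cvgMr_tmp; apply: cvgN; apply: cvg_id.
Qed.

(** For fixed [v] both sides of the bound are continuous in the exponent, since [<v, X^(-q) v>] is a
    finite sum of terms [x^(-q) w] with [x > 0]. Dyadic exponents therefore suffice. *)
Lemma powRN_lipschitzP (R : realType) (n : nat) (s : R) :
  0 <= s -> powRN_lipschitz n s.
Proof.
move=> s0 l X Y c l0 c0 hX hY hc.
apply: hermitian_opb_quad => [|v].
  by apply: adj_sub; exact: mxpowR_adj.
rewrite rdot_mulB.
pose g q := `|rdot v (mxpowR X (- q) *m v) - rdot v (mxpowR Y (- q) *m v)| -
  q * powR l (- q - 1) * c * rdot v v.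
rewrite -subr_le0; apply: (@continuous_dyadic_le0 _ g) => // [|m k]; last first.
  by rewrite subr_le0 -rdot_mulB; apply: opb_quad; exact: powRN_lipschitz_dyadic.
have sum_cont (Z : 'M[R[i]]_n) : posge l Z ->
    continuous (fun q => rdot v (mxpowR Z (- q) *m v)).
  move=> [hZ lZ]; under eq_fun do rewrite mxpowRE usp_quad.
  move=> q.
  apply: cvg_big => [|i _]; first exact: add_continuous.
  apply: cvgMr_tmp; apply: continuous_powRN.
  exact: lt_le_trans l0 (speceig_ge i hZ lZ).
move=> q; apply: cvgB.
- by apply: cvg_norm; apply: cvgB; apply: sum_cont.
- apply: cvgMr_tmp; apply: cvgMr_tmp; apply: cvgM; first exact: cvg_id.
  under eq_fun do rewrite -opprD.
  rewrite -opprD.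
  apply: (@cvg_comp _ _ _ (fun q => q + 1) (fun q => powR l (- q))).
    by apply: cvgD; [exact: cvg_id|exact: cvg_cst].
  exact: continuous_powRN.
Qed.

(** * The spectral norm as an operator bound, and its comparison with entries *)

Section SpectralNorm.
Variables (R : realType) (n : nat).
Implicit Types (v x : 'cV[R[i]]_n) (M N A : 'M[R[i]]_n) (c t : R).

(** [|M x|^2 = <x, M^* M x>] is bounded through the eigenvalues of [M^* M]. This makes the supremum
    in [specnorm] that of a bounded set. *)
Lemma opb_exists M : exists2 c, 0 <= c & opb M c.
Proof.
have hH : (M ^t* *m M) ^t* = M ^t* *m M.
  by rewrite trmx_mul map_mxM trmxCK.
pose c := \sum_i `|speceig (M ^t* *m M) i|.
have c0 : 0 <= c by apply: sumr_ge0.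
have hc : opb (M ^t* *m M) c.
  rewrite (hermitian_uspE hH); apply: usp_opb => [|i].
    exact: spectral_unitarymx.
  by rewrite /c (bigD1 i)//= lerDl sumr_ge0.
exists (Num.sqrt c) => [|x]; first exact: sqrtr_ge0.
rewrite -(@ler_pXn2r _ 2) ?nnegrE ?mulr_ge0 ?sqrtr_ge0 ?vnorm2_ge0//.
rewrite exprMn !sqr_vnorm2 sqr_sqrtr// rdot_adj mulmxA.
exact: le_trans (ler_norm _) (opb_quad _ hc).
Qed.

Lemma specnorm_le M c : 0 <= c -> opb M c -> specnorm M <= c.
Proof.
move=> c0 hc; rewrite /specnorm; set E := (X in sup X).
(* For [n = 0] there is no unit vector, and the supremum of the empty set is 0. *)
have [->|/set0P nE] := eqVneq E set0; first by rewrite sup0.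
apply: ge_sup => // _ [x /= x1 <-].
by have := hc x; rewrite x1 mulr1.
Qed.

Lemma specnorm_ub M x : vnorm2 x = 1 -> vnorm2 (M *m x) <= specnorm M.
Proof.
move=> x1; apply: ub_le_sup; last by exists x.
have [c c0 hc] := opb_exists M.
by exists c => _ [y /= y1 <-]; have := hc y; rewrite y1 mulr1.
Qed.

Lemma specnorm_ge0 M : 0 <= specnorm M.
Proof.
rewrite /specnorm; set E := (X in sup X).
have [->|/set0P[_ [x /= x1 _]]] := eqVneq E set0; first by rewrite sup0.
exact: le_trans (vnorm2_ge0 _) (specnorm_ub M x1).
Qed.

Lemma opb_specnorm M : opb M (specnorm M).
Proof.
move=> x; have [/eqP|x0] := eqVneq (vnorm2 x) 0.
  by move=> /eqP/vnorm2_eq0->; rewrite mulmx0 vnorm2_0 mulr0.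
have xp : 0 < vnorm2 x by rewrite lt_neqAle eq_sym x0 vnorm2_ge0.
have x1 : vnorm2 ((vnorm2 x)^-1%:C *: x) = 1.
  by rewrite vnorm2Z ger0_norm ?invr_ge0 ?vnorm2_ge0// mulVf.
have := specnorm_ub M x1; rewrite -scalemxAr vnorm2Z ger0_norm ?invr_ge0 ?vnorm2_ge0//.
by rewrite ler_pdivrMl// mulrC.
Qed.

Lemma opb0_eq0 M : opb M 0 -> M = 0.
Proof.
move=> h; apply/matrixP => i j; rewrite mxE.
have /vnorm2_eq0 : vnorm2 (M *m delta_mx j 0) = 0.
  by apply/eqP; rewrite eq_le vnorm2_ge0 andbT; have := h (delta_mx j 0); rewrite mul0r.
by rewrite -colE => /matrixP/(_ i 0); rewrite !mxE.
Qed.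

Lemma specnorm_eq0 M : specnorm M <= 0 -> M = 0.
Proof. by move=> h; apply: opb0_eq0; apply: opb_le h (opb_specnorm M). Qed.

Lemma opbZ M c t : opb M c -> opb (t%:C *: M) (`|t| * c).
Proof.
move=> h x; rewrite -scalemxAl vnorm2Z -mulrA.
by apply: ler_wpM2l.
Qed.

Lemma opb_sum (I : finType) (F : I -> 'M[R[i]]_n) (f : I -> R) :
  (forall k, opb (F k) (f k)) -> opb (\sum_k F k) (\sum_k f k).
Proof.
move=> h; elim/big_ind2: _ => // [x|]; first by rewrite mul0mx vnorm2_0 mul0r.
by move=> M c N d; apply: opbD.
Qed.

Lemma opb_entry M c i j : 0 <= c -> opb M c ->
  `|complex.Re (M i j)| <= c /\ `|complex.Im (M i j)| <= c.
Proof.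
move=> c0 h; have d1 : vnorm2 (delta_mx j 0 : 'cV[R[i]]_n) = 1.
  apply/eqP; rewrite -(@eqrXn2 _ 2) ?vnorm2_ge0// sqr_vnorm2 rdotE expr1n.
  rewrite (bigD1 j)//= big1 => [|k kj]; first by rewrite !mxE !eqxx /= !mulr0 mulr1 !addr0.
  by rewrite !mxE (negPf kj) /= !mulr0 addr0.
have : vnorm2 (M *m delta_mx j 0) ^+ 2 <= c ^+ 2.
  by rewrite ler_pXn2r ?nnegrE ?vnorm2_ge0//; have := h (delta_mx j 0); rewrite d1 mulr1.
rewrite -colE sqr_vnorm2 rdotE (bigD1 i)//= !mxE.
set S := \sum_(_ < n | _) _; have S0 : 0 <= S.
  by apply: sumr_ge0 => k _; rewrite -!expr2 addr_ge0 ?sqr_ge0.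
set a := complex.Re _; set b := complex.Im _ => le_c.
have := sqr_ge0 a; have := sqr_ge0 b; rewrite !expr2 => b2 a2.
by split; rewrite -(@ler_pXn2r _ 2) ?nnegrE// real_normK ?num_real// !expr2; lra.
Qed.

(** Expand [M] in matrix units, real and imaginary parts apart; [K] adds up the norms of all the
    units and of their multiples by ['i]. *)
Lemma opb_of_entries : exists2 K : R, 0 <= K &
  forall M e, (forall i j, `|complex.Re (M i j)| <= e /\ `|complex.Im (M i j)| <= e) ->
  opb M (K * e).
Proof.
pose E (i j : 'I_n) : 'M[R[i]]_n := delta_mx i j.
pose w i j := specnorm (E i j) + specnorm ('i *: E i j).
exists (\sum_i \sum_j w i j) => [|M e he].
  by do 2!apply: sumr_ge0 => ? _; rewrite addr_ge0 ?specnorm_ge0.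
rewrite [M]matrix_sum_delta mulr_suml; apply: opb_sum => i.
rewrite mulr_suml; apply: opb_sum => j.
have [hr hi] := he i j.
rewrite [M i j]complexE scalerDl mulrDl (mulrC 'i) -scalerA.
apply: opbD; rewrite mulrC.
  apply: opb_le (opbZ _ (opb_specnorm _)); rewrite ler_wpM2r ?specnorm_ge0//.
apply: opb_le (opbZ _ (opb_specnorm _)); rewrite ler_wpM2r ?specnorm_ge0//.
Qed.

End SpectralNorm.

(** * Convergence of sequences with geometric increments *)

Lemma geometric_limit (R : realType) (a : nat -> R) (c z : R) :
  0 <= c -> 0 <= z < 1 -> (forall k, `|a k.+1 - a k| <= c * z ^+ k) ->
  exists l, forall k, `|a k - l| <= c / (1 - z) * z ^+ k.
Proof.
move=> c0 /andP[z0 z1] ha; pose d := c / (1 - z).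
have d0 : 0 <= d by rewrite divr_ge0// subr_ge0 ltW.
(* With this [d] the bound [c z^k] equals [d z^k - d z^(k+1)], so the increments telescope. *)
have cE : c = d * (1 - z) by rewrite divfK// subr_eq0 gt_eqF.
have step k : `|a k.+1 - a k| <= d * z ^+ k - d * z ^+ k.+1.
  by apply: le_trans (ha k) _; rewrite cE exprS; lra.
have dz k : 0 <= d * z ^+ k by rewrite mulr_ge0 ?exprn_ge0.
have lo : {homo (fun k => a k - d * z ^+ k) : j k / (j <= k)%N >-> j <= k}.
  apply: homo_leq => [//|x y w|k]; first exact: le_trans.
  by have := step k; rewrite ler_norml => /andP[]; lra.
have hi : {homo (fun k => a k + d * z ^+ k) : j k / (j <= k)%N >-> k <= j}.
  apply: homo_leq => [//|x y w|k]; first by move=> h1 h2; exact: le_trans h2 h1.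
  by have := step k; rewrite ler_norml => /andP[]; lra.
have lohi j k : a j - d * z ^+ j <= a k + d * z ^+ k.
  have := lo _ _ (leq_maxl j k); have := hi _ _ (leq_maxr j k).
  by have := dz (maxn j k); lra.
pose E := range (fun k => a k - d * z ^+ k).
(* [a k - d z^k] increases, [a k + d z^k] decreases, and they enclose [sup E]. *)
exists (sup E) => k.
have h1 : a k - d * z ^+ k <= sup E.
  apply: ub_le_sup; last by exists k.
  by exists (a 0%N + d * z ^+ 0) => _ [j _ <-]; exact: lohi.
have h2 : sup E <= a k + d * z ^+ k.
  apply: ge_sup; first by exists (a 0%N - d * z ^+ 0); exists 0%N.
  by move=> _ [j _ <-]; exact: lohi.
by rewrite -/d ler_norml; apply/andP; split; lra.
Qed.

Section MatrixSequences.
Variables (R : realType) (n : nat).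
Implicit Types (X : nat -> 'M[R[i]]_n) (L : 'M[R[i]]_n).

(** Completeness, entry by entry: real and imaginary parts converge by [geometric_limit], and
    [opb_of_entries] turns these rates into one for the operator norm. *)
Lemma opb_geometric_limit X (c z : R) : 0 <= c -> 0 <= z < 1 ->
  (forall k, opb (X k.+1 - X k) (c * z ^+ k)) ->
  exists L, exists2 K, 0 <= K & forall k, opb (X k - L) (K * z ^+ k).
Proof.
move=> c0 z01 hX; have /andP[z0 z1] := z01; pose d := c / (1 - z).
have d0 : 0 <= d by rewrite divr_ge0// subr_ge0 ltW.
have /choice[L hL] : forall ij : 'I_n * 'I_n, exists l : R[i], forall k,
    `|complex.Re (X k ij.1 ij.2 - l)| <= d * z ^+ k /\
    `|complex.Im (X k ij.1 ij.2 - l)| <= d * z ^+ k.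
  move=> [i j] /=.
  have he k := opb_entry i j (mulr_ge0 c0 (exprn_ge0 k z0)) (hX k).
  have [|x hx] := @geometric_limit R (fun k => complex.Re (X k i j)) c z c0 z01.
    by move=> k; have [+ _] := he k; rewrite !mxE raddfB.
  have [|y hy] := @geometric_limit R (fun k => complex.Im (X k i j)) c z c0 z01.
    by move=> k; have [_] := he k; rewrite !mxE raddfB.
  by exists (x +i* y) => k; rewrite !raddfB; split; [exact: hx|exact: hy].
have [K K0 hK] := opb_of_entries R n.
exists (\matrix_(i, j) L (i, j)), (K * d); first exact: mulr_ge0.
move=> k; rewrite -mulrA; apply: hK => i j; rewrite !mxE.
exact: hL (i, j) k.
Qed.

(** The lower bound passes to the limit in each quadratic form; as [X k] is Hermitian, [L^* - L]
    differs from 0 by two errors of size [K z^k]. *)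
Lemma posge_limit X L (l K z : R) : 0 <= z < 1 -> 0 <= K ->
  (forall k, posge l (X k)) -> (forall k, opb (X k - L) (K * z ^+ k)) ->
  posge l L.
Proof.
move=> z01 K0 pX hX; have /andP[z0 _] := z01.
have e0 k : 0 <= K * z ^+ k by rewrite mulr_ge0 ?exprn_ge0.
split; last first.
  move=> v; rewrite -subr_le0; apply: (le0_expr_bound (c := K * rdot v v) z01) => k.
  have := opb_quad v (hX k); rewrite rdot_mulB ler_norml => /andP[_].
  by have := (pX k).2 v; lra.
apply/eqP; rewrite -subr_eq0; apply/eqP/specnorm_eq0.
apply: (le0_expr_bound (c := K + K) z01) => k; rewrite mulrDl.
apply: specnorm_le; first exact: addr_ge0.
have hE := (pX k).1.
have -> : L ^t* - L = (X k - L) - (X k - L) ^t*.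
  rewrite (_ : (X k - L) ^t* = X k - L ^t*); last by rewrite raddfB /= map_mxB hE.
  by rewrite opprB [RHS]addrC [RHS]addrA subrK.
by apply: opbB => //; apply: opb_adj.
Qed.

End MatrixSequences.

(** * Positive definite matrices and the smallest eigenvalue *)

Section PositiveDefinite.
Variables (R : realType) (n : nat).
Implicit Types (v : 'cV[R[i]]_n) (X Q : 'M[R[i]]_n) (l : R).

Lemma posdefmx_adj X : posdefmx X -> X ^t* = X.
Proof. by case; rewrite hermsymmx_adj => /eqP. Qed.

Lemma posdefmx_rdot X v : posdefmx X -> v != 0 -> 0 < rdot v (X *m v).
Proof.
by move=> [_ h] /h; rewrite ltcE /rdot mulmxA => /andP[].
Qed.

Lemma posge_posdefmx l X : 0 < l -> posge l X -> posdefmx X.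
Proof.
move=> l0 [hX lX]; split; first by rewrite hermsymmx_adj hX.
move=> x x0; rewrite -mulmxA.
have q0 : 0 < rdot x (X *m x).
  apply: lt_le_trans (lX x); rewrite mulr_gt0// lt_neqAle rdot_ge0 andbT eq_sym.
  by apply: contra_neq x0; exact: rdot_eq0.
(* The order of [R[i]] also asks for a zero imaginary part; the form equals its own conjugate
   because [X] is Hermitian. *)
suff im0 : complex.Im ((x ^t* *m (X *m x)) 0 0) = 0 by rewrite ltcE im0 eqxx.
have e : (x ^t* *m (X *m x)) ^t* = x ^t* *m (X *m x).
  by rewrite !trmx_mul !map_mxM trmxCK hX mulmxA.
move/matrixP/(_ 0 0): e; rewrite !mxE.
by case: (\sum_j _) => a b [] /eqP; rewrite eq_sym -addr_eq0 -mulr2n mulrn_eq0 => /eqP.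
Qed.

(** [eigenvalue] speaks of row vectors, [u Q = l u], so positivity is tested at the column
    [u ^t*]. *)
Lemma posdefmx_eigenvalue_gt0 Q l : posdefmx Q -> eigenvalue Q l%:C -> 0 < l.
Proof.
move=> pQ /eigenvalueP[u uQ u0].
have x0 : u ^t* != 0.
  by apply: contra_neq u0 => e; rewrite -[u]trmxCK e trmx0 map_mx0.
have := posdefmx_rdot pQ x0.
rewrite {1}/rdot trmxCK mulmxA uQ -[u]trmxCK -scalemxAl.
have -> : complex.Re ((l%:C *: (u ^t* ^t* *m u ^t* ^t* ^t*)) 0 0) = l * rdot (u ^t*) (u ^t*).
  by rewrite mxE /rdot !trmxCK; case: ((u *m _) 0 0) => a b /=; rewrite mul0r subr0.
by rewrite pmulr_lgt0// lt_neqAle rdot_ge0 andbT eq_sym; apply: contra_neq x0; exact: rdot_eq0.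
Qed.

Lemma speceig_eigenvalue Q i : Q ^t* = Q -> eigenvalue Q (speceig Q i)%:C.
Proof.
move=> hQ; have [v1 Qv] := usp_eig (speceig Q) i (spectral_unitarymx Q).
move: v1 Qv; set v := _ *m _ => v1; rewrite -(hermitian_uspE hQ) => Qv.
apply/eigenvalueP; exists (v ^t*).
  rewrite -[in LHS]hQ -map_mxM -trmx_mul Qv; apply/matrixP => j k; rewrite !mxE rmorphM.
  by congr (_ * _); exact: conjc_real.
apply/eqP => v0; move: v1; rewrite /rdot v0 mul0mx mxE /=.
by move/eqP; rewrite eq_sym oner_eq0.
Qed.

Lemma lambda_min_ge0 Q : posdefmx Q -> 0 <= lambda_min Q.
Proof.
move=> pQ; rewrite /lambda_min; set E := (X in inf X).
have [->|/set0P nE] := eqVneq E set0; first by rewrite inf0.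
by apply: lb_le_inf => // l /(posdefmx_eigenvalue_gt0 pQ)/ltW.
Qed.

Lemma posge_lambda_min Q : posdefmx Q -> posge (lambda_min Q) Q.
Proof.
move=> pQ; have hQ := posdefmx_adj pQ; split => //.
rewrite {2}(hermitian_uspE hQ); apply: usp_loew => [|i].
  exact: spectral_unitarymx.
apply: ge_inf; last exact: speceig_eigenvalue.
by exists 0 => l /(posdefmx_eigenvalue_gt0 pQ)/ltW.
Qed.

Lemma specnorm_ge l X : 0 <= l -> (0 < n)%N -> loew l X -> l <= specnorm X.
Proof.
move=> l0 n0 lX; have [v1 _] := usp_eig (speceig X) (Ordinal n0) (spectral_unitarymx X).
move: v1; set v := _ *m _ => v1.
have := lX v; have := opb_quad v (opb_specnorm X); rewrite v1 !mulr1 => h1 h2.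
by apply: le_trans h2 _; apply: le_trans (ler_norm _) h1.
Qed.

End PositiveDefinite.

Lemma lambda_min_size0 (R : realType) (Q : 'M[R[i]]_0) : lambda_min Q = 0.
Proof.
rewrite /lambda_min; set E := (X in inf X).
suff -> : E = set0 by rewrite inf0.
by apply/seteqP; split => // l /eigenvalueP[u _]; rewrite thinmx0 eqxx.
Qed.

Lemma subrDDl (V : zmodType) (q u v : V) : (q + u) - (q + v) = u - v.
Proof. by rewrite opprD addrACA subrr add0r. Qed.

(** * The fixed-point equation and its perturbation *)

Section Equation.
Variables (R : realType) (n : nat) (p l : R) (Q : 'M[R[i]]_n).
Hypotheses (p_gt0 : 0 < p) (l_gt0 : 0 < l) (geQ : posge l Q).
Implicit Types (A B X Y : 'M[R[i]]_n).

Definition eqmap A X := Q + A ^t* *m mxpowR X (- p) *m A.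

Lemma adj_conj A X : X ^t* = X -> (A ^t* *m X *m A) ^t* = A ^t* *m X *m A.
Proof. by move=> hX; rewrite !trmx_mul !map_mxM trmxCK hX mulmxA. Qed.

Lemma rdot_conj A X v :
  rdot v ((A ^t* *m X *m A) *m v) = rdot (A *m v) (X *m (A *m v)).
Proof. by rewrite -!mulmxA -rdot_adj. Qed.

(** Values of [powR] are nonnegative, so the term added to [Q] is positive semidefinite whatever [X]
    is. *)
Lemma posge_eqmap A X : posge l (eqmap A X).
Proof.
have [hQ lQ] := geQ; split.
  rewrite /eqmap; have := adj_conj A (mxpowR_adj X (- p)).
  by move: (_ *m A) => Z hZ; rewrite raddfD /= map_mxD hQ hZ.
move=> v; rewrite /eqmap; have := rdot_conj A (mxpowR X (- p)) v.
move: (_ *m A) => Z hZ; rewrite mulmxDl rdotDr hZ -[leLHS]addr0.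
apply: lerD; first exact: lQ.
rewrite mxpowRE usp_quad; apply: sumr_ge0 => i _.
by rewrite mulr_ge0 ?powR_ge0 ?specwt_ge0.
Qed.

(** A solution is a value of [eqmap A], hence at least [l I]. Uniqueness among all positive definite
    matrices thus reduces to uniqueness on the set where the map contracts. *)
Lemma posdef_solutionP A X :
  posdef_solution p A Q X <-> posge l X /\ eqmap A X = X.
Proof.
split=> [[_ XQ]|[pX XQ]].
  have XE : eqmap A X = X by rewrite /eqmap -[in LHS]XQ subrK.
  by split => //; rewrite -XE; exact: posge_eqmap.
split; first exact: posge_posdefmx pX.
by rewrite -{1}XQ /eqmap addrK.
Qed.

(** The Lipschitz constant of [eqmap A]: [p l^(-p-1)] from the power, [specnorm A ^+ 2] from the two
    outer factors. *)
Definition contr A : R := p * specnorm A ^+ 2 / powR l (p + 1).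

Lemma contr_ge0 A : 0 <= contr A.
Proof. by rewrite divr_ge0 ?powR_ge0// mulr_ge0 ?sqr_ge0// ltW. Qed.

Lemma powRN_succ : powR l (- p - 1) = (powR l (p + 1))^-1.
Proof. by rewrite -opprD powRN. Qed.

Lemma powRN_eq : powR l (- p) = l / powR l (p + 1).
Proof.
rewrite -powRN_succ -[X in X * _](powRr1 (ltW l_gt0)) -powRD_gt0//.
by congr powR; ring.
Qed.

Lemma conj_diff A U V :
  A ^t* *m U *m A - A ^t* *m V *m A = A ^t* *m (U - V) *m A :> 'M[R[i]]_n.
Proof. by rewrite mulmxBr mulmxBl. Qed.

Lemma opb_conj A U c : 0 <= c -> opb U c ->
  opb (A ^t* *m U *m A) (specnorm A ^+ 2 * c).
Proof.
move=> c0 hU; have a0 := specnorm_ge0 A; have hA := opb_specnorm A.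
rewrite (_ : _ * c = specnorm A * c * specnorm A); last by ring.
by apply: opbM; rewrite ?mulr_ge0//; apply: opbM => //; apply: opb_adj.
Qed.

Lemma opb_conj_powRN A X Y c : 0 <= c -> posge l X -> posge l Y ->
  opb (X - Y) c ->
  opb (A ^t* *m (mxpowR X (- p) - mxpowR Y (- p)) *m A) (contr A * c).
Proof.
move=> c0 pX pY hc; have h := powRN_lipschitzP (ltW p_gt0) l_gt0 c0 pX pY hc.
have d0 : 0 <= p * powR l (- p - 1) * c by rewrite !mulr_ge0 ?powR_ge0// ltW.
rewrite (_ : contr A * c = specnorm A ^+ 2 * (p * powR l (- p - 1) * c)).
  exact: opb_conj.
by rewrite powRN_succ /contr; ring.
Qed.

Lemma opb_eqmap A X Y c : 0 <= c -> posge l X -> posge l Y ->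
  opb (X - Y) c -> opb (eqmap A X - eqmap A Y) (contr A * c).
Proof.
move=> c0 pX pY /(opb_conj_powRN A c0 pX pY) h.
by rewrite [_ - _](subrDDl Q) [_ - _]conj_diff.
Qed.

Lemma solution_unique A X Y : contr A < 1 ->
  posge l X -> posge l Y -> eqmap A X = X -> eqmap A Y = Y -> X = Y.
Proof.
move=> q1 pX pY hX hY; apply/eqP; rewrite -subr_eq0; apply/eqP/specnorm_eq0.
have c0 := specnorm_ge0 (X - Y).
have := opb_eqmap A c0 pX pY (opb_specnorm _); rewrite hX hY.
have q0 := contr_ge0 A.
move=> /(specnorm_le (mulr_ge0 q0 c0)) h; rewrite leNgt; apply/negP => c_gt0.
by move: h; rewrite leNgt gtr_pMl// q1.
Qed.

(** Banach iteration started at [Q]. *)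
Lemma solution_exists A : contr A < 1 -> exists2 X, posge l X & eqmap A X = X.
Proof.
move=> q1; have q0 := contr_ge0 A; set q := contr A in q0 q1.
have q01 : 0 <= q < 1 by rewrite q0.
pose X k := iter k (eqmap A) Q.
have pX k : posge l (X k) by case: k => [|k]; [exact: geQ|exact: posge_eqmap].
pose c := specnorm (X 1%N - X 0%N).
have c0 : 0 <= c := specnorm_ge0 _.
have hX k : opb (X k.+1 - X k) (c * q ^+ k).
  elim: k => [|k IH]; first by rewrite mulr1; exact: opb_specnorm.
  have e0 : 0 <= c * q ^+ k by rewrite mulr_ge0 ?exprn_ge0.
  have := opb_eqmap A e0 (pX k.+1) (pX k) IH.
  by rewrite (_ : contr A * _ = c * q ^+ k.+1)// exprS mulrCA.
have [L [K K0 hL]] := opb_geometric_limit c0 q01 hX.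
have pL := posge_limit q01 K0 pX hL.
exists L => //; apply/eqP; rewrite -subr_eq0; apply/eqP/specnorm_eq0.
(* The residual of [L] is split into [X k.+1 - L], bounded by [K q^(k+1)], and the difference of the
   images of [X k] and [L], bounded by [q K q^k]. *)
apply: (le0_expr_bound (c := q * K + q * K) q01) => k.
have e0 j : 0 <= K * q ^+ j by rewrite mulr_ge0 ?exprn_ge0.
have h1 := opb_eqmap A (e0 k) (pX k) pL (hL k).
have h2 := hL k.+1.
have -> : eqmap A L - L = (X k.+1 - L) - (eqmap A (X k) - eqmap A L).
  by rewrite /X /= opprB [RHS]addrC addrA subrK.
apply: specnorm_le.
  by apply: mulr_ge0; [apply: addr_ge0; exact: mulr_ge0|exact: exprn_ge0].
apply: opb_eq (opbB h2 h1).
by rewrite exprS -/q; ring.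
Qed.

Lemma solution_exists_unique A : contr A < 1 ->
  exists! X, posdef_solution p A Q X.
Proof.
move=> q1; have [X pX hX] := solution_exists q1.
exists X; split; first by apply/posdef_solutionP.
by move=> Y /posdef_solutionP[pY hY]; exact: (solution_unique q1).
Qed.

(** The change from [U] to [V] is isolated from the change of [A]. The last two terms are at most
    [|V| |D| (|A| + |D|)] and [|V| |A| |D|], whence the factor [2|A| + |D|]. *)
Lemma conj_perturb A D U V :
  (A + D) ^t* *m V *m (A + D) - A ^t* *m U *m A =
  A ^t* *m (V - U) *m A + (D ^t* *m V *m (A + D) + A ^t* *m V *m D)
  :> 'M[R[i]]_n.
Proof.
rewrite -conj_diff (_ : (A + D) ^t* = A ^t* + D ^t*); last first.
  by rewrite raddfD /= map_mxD.
rewrite !mulmxDl !mulmxDr.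
move: (A ^t* *m V *m A) (A ^t* *m V *m D) => a b.
move: (D ^t* *m V *m A) (D ^t* *m V *m D) => c d.
by rewrite addrAC (addrAC a) (addrC (c + d)) [RHS]addrA.
Qed.

Lemma perturbation_bound A D X Xt : (0 < n)%N -> contr A < 1 ->
  posge l X -> posge l Xt -> eqmap A X = X -> eqmap (A + D) Xt = Xt ->
  specnorm (Xt - X) / specnorm X <=
  (2 * specnorm A + specnorm D)
    / (powR l (p + 1) - p * specnorm A ^+ 2) * specnorm D.
Proof.
move=> n0 q1 pX pXt hX hXt.
set a := specnorm A; set d := specnorm D; set e := specnorm (Xt - X).
have [a0 d0 e0] : [/\ 0 <= a, 0 <= d & 0 <= e] by split; exact: specnorm_ge0.
set W := powR l (p + 1); have W0 : 0 < W by rewrite powR_gt0.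
have lX : l <= specnorm X := specnorm_ge (ltW l_gt0) n0 pX.2.
have X0 : 0 < specnorm X := lt_le_trans l_gt0 lX.
have hA : opb A a := opb_specnorm A.
have hD : opb D d := opb_specnorm D.
have hZ := opb_mxpowRN l_gt0 (ltW p_gt0) pXt.
have z0 : 0 <= powR l (- p) := powR_ge0 _ _.
have main : opb (Xt - X) (contr A * e +
    (d * powR l (- p) * (a + d) + a * powR l (- p) * d)).
  rewrite -{1}hXt -{1}hX [_ - _](subrDDl Q) [_ - _]conj_perturb.
  have h1 := opbM (mulr_ge0 d0 z0) (opbM d0 (opb_adj d0 hD) hZ) (opbD hA hD).
  have h2 := opbM (mulr_ge0 a0 z0) (opbM a0 (opb_adj a0 hA) hZ) hD.
  have h3 := opb_conj_powRN A e0 pXt pX (opb_specnorm _).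
  exact: opbD h3 (opbD h1 h2).
have {main} := specnorm_le (addr_ge0 (mulr_ge0 (contr_ge0 A) e0)
  (addr_ge0 (mulr_ge0 (mulr_ge0 d0 z0) (addr_ge0 a0 d0))
            (mulr_ge0 (mulr_ge0 a0 z0) d0))) main.
rewrite -/e /contr -/a -/W powRN_eq -/W => main.
have q1' : p * a ^+ 2 < W by move: q1; rewrite /contr ltr_pdivrMr// mul1r.
(* Multiplying by [W = l^(p+1)] turns the contraction constant into [p a^2] and [l^(-p)] into
   [l]. *)
have : e * (W - p * a ^+ 2) <= l * ((2 * a + d) * d).
  have := ler_wpM2r (ltW W0) main.
  set r := (X in _ <= X).
  have -> : r = p * a ^+ 2 * e + l * ((2 * a + d) * d).
    by rewrite /r; field; rewrite gt_eqF.
  by rewrite -lerBlDl mulrBr (mulrC (p * _)).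
move=> h; rewrite ler_pdivrMr//.
(* The remaining factor [l] is absorbed by [specnorm X]. *)
rewrite (_ : _ * specnorm X = ((2 * a + d) * d * specnorm X) / (W - p * a ^+ 2)).
  rewrite ler_pdivlMr ?subr_gt0//; apply: le_trans h _.
  rewrite [leLHS]mulrC; apply: ler_wpM2l lX.
  exact: mulr_ge0 (addr_ge0 (mulr_ge0 (ler0n _ 2) a0) d0) d0.
by ring.
Qed.

End Equation.

Lemma contr_lt1 (R : realType) (n : nat) (p l : R) (A : 'M[R[i]]_n) :
  0 < p -> 0 < l -> specnorm A < Num.sqrt (powR l (p + 1) / p) ->
  contr p l A < 1.
Proof.
move=> p0 l0 h; have W0 : 0 < powR l (p + 1) by rewrite powR_gt0.
rewrite /contr ltr_pdivrMr// mul1r mulrC -ltr_pdivlMr//.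
rewrite -[ltRHS]sqr_sqrtr ?divr_ge0 ?ltW//.
by rewrite ltr_pXn2r ?nnegrE ?sqrtr_ge0 ?specnorm_ge0.
Qed.

Theorem theorem4p2 (R : realType) (n : nat) (p : R) (A dA Q : 'M[R[i]]_n)
  (p_gt1 : 1 < p)
  (Q_posdef : posdefmx Q)
  (A_small : specnorm A < Num.sqrt (powR (lambda_min Q) (p + 1) / p))
  (dA_small :
     specnorm dA < Num.sqrt (powR (lambda_min Q) (p + 1) / p) - specnorm A) :
  (exists! X : 'M[R[i]]_n, posdef_solution p A Q X) /\
  (exists! Xt : 'M[R[i]]_n, posdef_solution p (A + dA) Q Xt) /\
  (forall X Xt : 'M[R[i]]_n,
     posdef_solution p A Q X -> posdef_solution p (A + dA) Q Xt ->
     specnorm (Xt - X) / specnorm X <=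
     (2 * specnorm A + specnorm dA)
       / (powR (lambda_min Q) (p + 1) - p * specnorm A ^+ 2) * specnorm dA).
Proof.
have p0 : 0 < p by apply: lt_trans p_gt1.
(* Were it 0, [A_small] would put a nonnegative norm strictly below [Num.sqrt 0]. *)
have l0 : 0 < lambda_min Q.
  rewrite lt_neqAle lambda_min_ge0// andbT; apply/eqP => l0.
  have := le_lt_trans (specnorm_ge0 A) A_small.
  by rewrite -l0 powR0 ?mul0r ?sqrtr0 ?ltxx// gt_eqF// addr_gt0.
(* In size 0 the infimum runs over the empty set and would be 0. *)
have n0 : (0 < n)%N.
  by case: n Q l0 {A dA Q_posdef A_small dA_small} => // Q; rewrite lambda_min_size0 ltxx.
have gQ := posge_lambda_min Q_posdef.
have qA := contr_lt1 p0 l0 A_small.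
(* By the triangle inequality, [dA_small] keeps [A + dA] below the threshold imposed on [A]. *)
have qAd : contr p (lambda_min Q) (A + dA) < 1.
  apply: contr_lt1 => //; apply: le_lt_trans (_ : specnorm A + specnorm dA < _).
    by apply: specnorm_le; rewrite ?addr_ge0 ?specnorm_ge0//; apply: opbD; exact: opb_specnorm.
  by rewrite -ltrBrDl.
split; first exact: (solution_exists_unique p0 l0 gQ).
split; first exact: (solution_exists_unique p0 l0 gQ).
move=> X Xt /(posdef_solutionP p l0 gQ)[pX hX] /(posdef_solutionP p l0 gQ)[pXt hXt].
exact: (perturbation_bound p0 l0 n0 qA pX pXt hX hXt).
Qed.
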